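(* Let $q\in L^1(0,\infty)$ be real-valued and let $H^D$ be the self-adjoint operator in $L^2(0,\infty)$ given by $H^D\varphi=-\varphi''+(x+q(x))\varphi$ on the domain of $\varphi\in L^2(0,\infty)$ with $\varphi,\varphi'$ locally absolutely continuous on $[0,\infty)$, $-\varphi''+(x+q)\varphi\in L^2(0,\infty)$, and $\varphi(0)=0$. Let $\lambda_1^D<\lambda_2^D<\cdots$ be its (simple) eigenvalues, and define the norming constants $\nu_k^D$ by \[ \frac{1}{\nu_k^D}=\frac{\|\varphi_k\|_{L^2(0,\infty)}^2}{\big(\varphi_k'(0)\big)^2}, \] where $\varphi_k$ is any nonzero eigenfunction of $H^D$ for $\lambda_k^D$. Then \[ \frac{1}{\nu_k^D}=1+o(1),\qquad k\to\infty. \]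
   Context: The quotient defining $\nu_k^D$ does not depend on the choice of the (one-dimensional) eigenfunction $\varphi_k$. *)

(* Defs.v *)
From HB Require Import structures.
From mathcomp Require Import all_boot all_order all_algebra.
From mathcomp Require Import all_classical all_reals all_analysis.
Set Implicit Arguments. Unset Strict Implicit. Unset Printing Implicit Defensive.
Import Order.TTheory GRing.Theory Num.Theory.
Import numFieldNormedType.Exports.
Local Open Scope classical_set_scope.
Local Open Scope ring_scope.

Definition AC_on {R : realType} (f : R -> R) (a b : R) : Prop :=
  forall e : R, 0 < e -> exists2 d : R, 0 < d &
    forall (n : nat) (u v : 'I_n -> R),
      (forall i, a <= u i /\ u i <= v i /\ v i <= b) ->
      (forall i j, i != j -> v i <= u j \/ v j <= u i) ->
      \sum_(i < n) (v i - u i) < d ->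
      \sum_(i < n) `|f (v i) - f (u i)| < e.

Definition locAC {R : realType} (f : R -> R) : Prop :=
  forall b : R, 0 < b -> AC_on f 0 b.

Definition L2_pos {R : realType} (f : R -> R) : Prop :=
  measurable_fun (`[0%R, +oo[ : set R) f /\
  (\int[lebesgue_measure]_(x in (`[0%R, +oo[ : set R)) ((f x) ^+ 2)%:E < +oo)%E.

Definition normsq {R : realType} (f : R -> R) : R :=
  fine (\int[lebesgue_measure]_(x in (`[0%R, +oo[ : set R)) ((f x) ^+ 2)%:E)%E.

Definition L1_pos {R : realType} (q : R -> R) : Prop :=
  lebesgue_measure.-integrable (`[0%R, +oo[ : set R) (EFin \o q).

(* phi is a nonzero eigenfunction of the Dirichlet operator
   H^D = -d^2/dx^2 + x + q(x), phi(0) = 0, for the eigenvalue lam;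
   dphi is the locally absolutely continuous representative of phi'. *)
Definition dirichlet_eigenfunction {R : realType} (q : R -> R) (lam : R)
    (phi dphi : R -> R) : Prop :=
  L2_pos phi /\
  ~ {ae lebesgue_measure, forall x, 0 <= x -> phi x = 0} /\
  locAC phi /\ locAC dphi /\
  {ae lebesgue_measure, forall x, 0 < x ->
      derivable phi x 1 /\ derive1 phi x = dphi x} /\
  {ae lebesgue_measure, forall x, 0 < x ->
      derivable dphi x 1 /\ - derive1 dphi x + (x + q x) * phi x = lam * phi x} /\
  phi 0 = 0.

Definition dirichlet_eigenvalue {R : realType} (q : R -> R) (lam : R) : Prop :=
  exists phi dphi, dirichlet_eigenfunction q lam phi dphi.

(* Main.v *)
Require Import Defs.
From HB Require Import structures.
From mathcomp Require Import all_boot all_order all_algebra.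
From mathcomp Require Import all_classical all_reals all_analysis.
From mathcomp Require Import measurable_realfun ring lra.
Import Order.TTheory GRing.Theory Num.Theory.
Import numFieldNormedType.Exports.
Local Open Scope classical_set_scope.
Local Open Scope ring_scope.
Set Implicit Arguments.
Unset Strict Implicit.
Unset Printing Implicit Defensive.

(* For a solution of -phi'' + (x + q) phi = lam phi one has, almost everywhere,
     (phi'^2 + (lam - x) phi^2)' = - phi^2 + 2 q phi phi',
   so that integration over [0, oo[, with phi 0 = 0 and phi' 0 = 1, gives
     ||phi||^2 = 1 + 2 int q phi phi'.
   It remains to see that phi phi' is bounded uniformly in lam, and is O(1/s) on
   [0, M] once lam >= M + s^2; as q is integrable this makes the last integral
   small. Left of the turning point x = lam this follows from Gronwall's
   inequality for phi'^2 + (lam - x) phi^2, near it from the one for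
   phi^2 + phi'^2, and right of it from the monotonicity of a perturbation of
   phi phi' which is forced to be nonpositive by phi being square integrable.
   That lam k tends to infinity comes from a uniform gap between eigenvalues in a
   bounded set.
   The only tool for absolutely continuous functions is that an almost everywhere
   nonnegative derivative makes them nondecreasing. *)

(** * Absolute continuity on compact intervals and its closure properties *)

Section AbsoluteContinuity.
Context {R : realType}.
Implicit Types (f g h : R -> R) (a b : R) (s : seq (R * R)).

(** Lists suit the covering argument below, which adds one interval at a time. Each entry lies to
    the right of all later ones, so a new rightmost interval goes in front. *)
Lemma AC_on_seq f a b : AC_on f a b ->
  forall e : R, 0 < e -> exists2 d : R, 0 < d & forall s,
    (forall p, p \in s -> [/\ a <= p.1, p.1 <= p.2 & p.2 <= b]) ->
    pairwise (fun p r => r.2 <= p.1) s ->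
    \sum_(p <- s) (p.2 - p.1) < d ->
    \sum_(p <- s) `|f p.2 - f p.1| < e.
Proof.
move=> acf e e0; have [d d0 acd] := acf e e0; exists d => // s sab.
move=> /(pairwiseP (0, 0)) pws; rewrite (big_tnth _ _ s) => sd; rewrite (big_tnth _ _ s).
apply: (acd _ (fun i => (tnth (in_tuple s) i).1)
  (fun i => (tnth (in_tuple s) i).2)) => // [i|i j ij].
  by have [] := sab _ (mem_tnth i (in_tuple s)).
rewrite !(tnth_nth (0, 0)) /=.
have [lij|lji|/val_inj eij] := ltngtP i j.
- by right; apply: pws => //; rewrite inE ltn_ord.
- by left; apply: pws => //; rewrite inE ltn_ord.
- by rewrite eij eqxx in ij.
Qed.

Lemma AC_on_unif f a b : AC_on f a b -> forall e : R, 0 < e ->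
  exists2 d : R, 0 < d & forall u v, a <= u -> u <= v -> v <= b -> v - u < d ->
    `|f v - f u| < e.
Proof.
move=> acf e e0; have [d d0 acd] := AC_on_seq acf e0; exists d => // u v au uv vb uvd.
have := acd [:: (u, v)]; rewrite !big_seq1 /=; apply => // p.
by rewrite inE => /eqP ->.
Qed.

(** Steps of length [d / 2] change [f] by at most 1 each, and boundedly many of them lead from [a]
    to any point. *)
Lemma AC_on_bounded f a b : AC_on f a b ->
  exists2 M : R, 0 < M & forall x, a <= x <= b -> `|f x| <= M.
Proof.
move=> acf; have [d d0 acd] := AC_on_unif acf ltr01.
have bnd n : forall x, a <= x <= b -> x - a <= n%:R * (d / 2) ->
    `|f x - f a| <= n%:R.
  elim: n => [|n IH] x /andP[ax xb] xn.
    have -> : x = a by apply/le_anti; rewrite ax andbT; lra.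
    by rewrite subrr normr0.
  have [xs|xs] := leP (x - a) (n%:R * (d / 2)).
    by rewrite (le_trans (IH x _ xs)) ?ax ?ler_nat.
  have h0 : 0 <= n%:R * (d / 2) by rewrite mulr_ge0// ltW// divr_gt0.
  rewrite -natr1 mulrDl mul1r in xn.
  rewrite -natr1 -(subrKA (f (a + n%:R * (d / 2)))) addrC.
  rewrite (le_trans (ler_normD _ _))// lerD//.
    by apply: IH; [apply/andP; split; lra|lra].
  by apply/ltW/acd; lra.
exists (`|f a| + (Num.bound ((b - a) / (d / 2)))%:R).
  by rewrite ltr_wpDl// ltr0n /Num.bound.
move=> x xab; rewrite -[f x](subrK (f a)) addrC (le_trans (ler_normD _ _))// lerD2l.
apply: bnd => //; rewrite -ler_pdivrMr ?divr_gt0//.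
have /andP[ax xb] := xab.
rewrite (@le_trans _ _ ((b - a) / (d / 2)))//.
  by rewrite ler_pM2r ?invr_gt0 ?divr_gt0//; lra.
by rewrite ltW// archi_boundP// divr_ge0//; [lra|rewrite ltW// divr_gt0].
Qed.

(** Common source of the closure properties: increments of sums, products and exponentials are
    controlled by those of the given functions. *)
Lemma AC_on_dom h f g a b K : 0 < K -> AC_on f a b -> AC_on g a b ->
  (forall u v, a <= u <= b -> a <= v <= b ->
    `|h v - h u| <= K * (`|f v - f u| + `|g v - g u|)) -> AC_on h a b.
Proof.
move=> K0 acf acg hK e e0.
have eK0 : 0 < e / K / 2 by rewrite !divr_gt0.
have [d1 d10 H1] := acf _ eK0; have [d2 d20 H2] := acg _ eK0.
exists (Num.min d1 d2); first by rewrite lt_min d10.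
move=> n u v uv dis; rewrite lt_min => /andP[s1 s2].
apply: (@le_lt_trans _ _ (K * (\sum_(i < n) `|f (v i) - f (u i)| +
    \sum_(i < n) `|g (v i) - g (u i)|))).
  rewrite -big_split mulr_sumr ler_sum// => i _; have [au [ub vb]] := uv i.
  by apply: hK; apply/andP; split => //; lra.
by rewrite mulrC -ltr_pdivlMr// [ltRHS]splitr ltrD// (H1, H2).
Qed.

Lemma locAC_dom h f g : locAC f -> locAC g ->
  (forall b : R, 0 < b -> exists2 K : R, 0 < K & forall u v, 0 <= u <= b -> 0 <= v <= b ->
    `|h v - h u| <= K * (`|f v - f u| + `|g v - g u|)) -> locAC h.
Proof.
move=> acf acg hK b b0; have [K K0 {}hK] := hK b b0.
exact: AC_on_dom K0 (acf b b0) (acg b b0) hK.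
Qed.

Lemma locAC_id : locAC (@id R).
Proof.
move=> b b0 e e0; exists e => // n u v uv _ sd; apply: le_lt_trans sd.
by apply: ler_sum => i _; have [_ [? _]] := uv i; rewrite ger0_norm// subr_ge0.
Qed.

Lemma locAC_cst (c : R) : locAC (cst c).
Proof.
apply: (locAC_dom locAC_id locAC_id) => b b0; exists 1 => // u v _ _ /=.
by rewrite subrr normr0 mul1r addr_ge0.
Qed.

Lemma locACD f g : locAC f -> locAC g -> locAC (fun x => f x + g x).
Proof.
move=> acf acg; apply: (locAC_dom acf acg) => b b0; exists 1 => // u v _ _ /=.
have -> : f v + g v - (f u + g u) = (f v - f u) + (g v - g u) by ring.
by rewrite mul1r ler_normD.
Qed.

Lemma locACM f g : locAC f -> locAC g -> locAC (fun x => f x * g x).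
Proof.
move=> acf acg; apply: (locAC_dom acf acg) => b b0.
have [M M0 fM] := AC_on_bounded (acf b b0).
have [N N0 gN] := AC_on_bounded (acg b b0).
exists (M + N); first exact: addr_gt0.
move=> u v ub vb /=.
have -> : f v * g v - f u * g u = (f v - f u) * g v + f u * (g v - g u) by ring.
rewrite (le_trans (ler_normD _ _))// !normrM mulrDr lerD//.
  rewrite mulrC ler_wpM2r//; have := gN v vb; lra.
by rewrite ler_wpM2r//; have := fM u ub; lra.
Qed.

Lemma locAC_exp f : locAC f -> locAC (fun x => expR (f x)).
Proof.
move=> acf; apply: (locAC_dom acf acf) => b b0.
have [M M0 fM] := AC_on_bounded (acf b b0).
exists (expR M); first exact: expR_gt0.
have expd (x y : R) : x <= y -> y <= M -> expR y - expR x <= expR M * (y - x).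
  move=> xy yM; have := expR_ge1Dx (x - y) => E1.
  have : expR x >= expR y * (1 + (x - y)).
    have -> : expR x = expR y * expR (x - y) by rewrite -expRD addrC subrK.
    by rewrite ler_wpM2l// expR_ge0.
  have : expR y * (y - x) <= expR M * (y - x) by rewrite ler_wpM2r ?ler_expR ?subr_ge0.
  lra.
move=> u v /fM uM /fM vM.
have um : f u <= M := le_trans (ler_norm _) uM.
have vm : f v <= M := le_trans (ler_norm _) vM.
rewrite (@le_trans _ _ (expR M * `|f v - f u|))//; last first.
  by rewrite ler_wpM2l ?expR_ge0// lerDl.
wlog uv : u v {uM vM} um vm / f u <= f v => [hw|].
  have [/hw|/ltW /hw] := leP (f u) (f v); first exact.
  by rewrite distrC (distrC (f u)); exact.
by rewrite !ger0_norm ?subr_ge0 ?ler_expR//; exact: expd.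
Qed.

End AbsoluteContinuity.

(** * Monotonicity from an almost everywhere nonnegative derivative *)

Section Monotonicity.
Context {R : realType}.
Local Notation mu := (@lebesgue_measure R).
Implicit Types (f : R -> R) (a b : R) (s : seq (R * R)).

(** Adding the one-sided estimates on both sides of [x] gives a loss proportional to [v - u],
    wherever [x] lies between them. *)
Lemma is_derive_ge0_local f (x l e : R) : is_derive x 1 f l -> 0 <= l -> 0 < e ->
  exists2 d : R, 0 < d & forall u v, x - d < u -> u <= x -> x <= v -> v < x + d ->
    - (e * (v - u)) <= f v - f u.
Proof.
move=> [dfx dfl] l0 e0.
have : h^-1 *: (f (h *: 1 + x) - f x) @[h --> 0^'] --> l by rewrite -dfl.
move=> /cvgrPdist_lt /(_ e e0) [d d0 H]; exists d => // u v ud ux xv vd.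
have {}H h : `|h| < d -> h != 0 -> - e < h^-1 * (f (h + x) - f x).
  move=> hd h0; have := H h; rewrite /ball_/= sub0r normrN => /(_ hd h0).
  rewrite /GRing.scale/= mulr1 => /(le_lt_trans (ler_norm _)); lra.
have Hv : - (e * (v - x)) <= f v - f x.
  have [->|vx] := eqVneq v x; first by rewrite !subrr mulr0 oppr0.
  have xv0 : 0 < v - x by rewrite subr_gt0 lt_neqAle eq_sym vx.
  have := H (v - x); rewrite subrK gtr0_norm// gt_eqF// => /(_ _ isT) HH.
  have {HH} : - e < (v - x)^-1 * (f v - f x) by apply: HH; lra.
  by rewrite mulrC ltr_pdivlMr// mulNr => /ltW.
have Hu : - (e * (x - u)) <= f x - f u.
  have [->|ux'] := eqVneq u x; first by rewrite !subrr mulr0 oppr0.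
  have xu0 : u - x < 0 by rewrite subr_lt0 lt_neqAle ux'.
  have := H (u - x); rewrite subrK ltr0_norm// lt_eqF// => /(_ _ isT) HH.
  have {HH} : - e < (u - x)^-1 * (f u - f x) by apply: HH; lra.
  by rewrite mulrC ltr_ndivlMr//; lra.
lra.
Qed.

(* A Cousin-type argument: [a, b] is exhausted by finitely many small intervals
   that either carry a difference quotient at least -e, or lie in an open set of
   small measure containing the exceptional null set; absolute continuity
   controls the total increment over the latter. *)
Lemma AC_on_le f a b : a <= b -> AC_on f a b ->
  {ae mu, forall x, a < x < b -> exists2 l, is_derive x 1 f l & 0 <= l} ->
  f a <= f b.
Proof.
move=> ab acf [N [mN N0 NP]].
apply/ler_addgt0Pr => e' e'0.
have ba1 : 0 < b - a + 1 by lra.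
(* The total loss is [e * (b - a)] from the good intervals plus [e] from the exceptional ones. *)
pose e := e' / (b - a + 1); have e0 : 0 < e by rewrite divr_gt0.
suff : f a - f b <= e * (b - a + 1) by rewrite divfK ?gt_eqF//; lra.
have [d d0 acd] := AC_on_seq acf e0.
pose N' := N `|` ([set a] `|` [set b]).
have mN' : measurable N' by apply: measurableU => //; exact: measurableU.
have N'0 : (mu N' = 0)%E.
  apply/negligibleP => //; apply: negligibleU; first exact/negligibleP.
  by apply: negligibleU; apply/negligibleP => //; exact: lebesgue_measure_set1.
have [U [oU N'U Ud]] : exists U, [/\ open U, N' `<=` U & (mu U < d%:E)%E].
  have N'oo : (mu N' < +oo)%E by rewrite N'0.
  have [U [oU N'U Ud]] := lebesgue_regularity_outer mN' N'oo d0.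
  exists U; split => //; have mU := measurable_realfun.open_measurable oU.
  have : (mu (N' `|` (U `\` N')) <= mu N' + mu (U `\` N'))%E.
    by apply: measureU2 => //; exact: measurableD.
  by rewrite N'0 add0e setDUK// => /le_lt_trans; apply.
have mU := measurable_realfun.open_measurable oU.
pose S := [set x | a <= x <= b /\ exists s,
  [/\ forall p, p \in s -> [/\ a <= p.1, p.1 <= p.2 & p.2 <= x],
      pairwise (fun p r => r.2 <= p.1) s,
      ((\sum_(p <- s) (p.2 - p.1))%:E <= mu (U `&` `]a, x]))%E &
      - (e * (x - a)) - \sum_(p <- s) `|f p.2 - f p.1| <= f x - f a]].
have Sa : S a.
  split; first by rewrite lexx.
  by exists [::]; split; rewrite ?big_nil ?subrr ?mulr0 ?oppr0 ?addr0.
have Sstep u v : S u -> u <= v <= b ->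
    - (e * (v - u)) <= f v - f u \/ `]u, v] `<=` U -> S v.
  move=> [/andP[au ub] [s [sau pws ms fs]]] /andP[uv vb] H.
  split; first by rewrite vb andbT (le_trans au).
  have mUu : measurable (U `&` `]a, u]) by exact: measurableI.
  have mUv : measurable (U `&` `]a, v]) by exact: measurableI.
  case: H => [fuv|uvU].
    exists s; split => //.
    - by move=> p /sau[? ? pu]; split => //; exact: le_trans uv.
    - rewrite (le_trans ms)// le_measure ?inE//; apply: setIS => x/=.
      by rewrite !in_itv/= => /andP[-> xu]; exact: le_trans uv.
    - lra.
  exists ((u, v) :: s); split.
  - move=> p; rewrite inE => /orP[/eqP->//|/sau[? ? pu]]; split => //.
    exact: le_trans uv.
  - by rewrite /= pws andbT; apply/allP => p /sau[].
  - rewrite big_cons /=.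
    rewrite (@le_trans _ _ (mu (`]u, v]%classic `|` (U `&` `]a, u])))%E)//; last first.
      rewrite le_measure ?inE//; first exact: measurableU.
      move=> x [/= xuv|[Ux /=]].
        split; first exact: uvU.
        by move: xuv; rewrite /= !in_itv/= => /andP[ux ->]; rewrite (le_lt_trans au).
      by rewrite !in_itv/= => /andP[-> xu]; split => //; exact: le_trans uv.
    rewrite measureU//; last first.
      rewrite -subset0 => x [/=]; rewrite !in_itv/= => /andP[ux _] [_ /andP[_]].
      by rewrite leNgt ux.
    rewrite EFinD leeD//= lebesgue_measure_itv/= lte_fin.
    by case: ltP => [_|vu]; rewrite -?EFinB lee_fin//; lra.
  - rewrite big_cons/=; have := ler_norm (f u - f v); rewrite distrC.
    have : 0 <= e * (v - u) by rewrite mulr_ge0 ?subr_ge0// ltW.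
    lra.
have Sloc c : a <= c <= b -> exists2 d' : R, 0 < d' & forall u v,
    c - d' < u -> u <= c -> c <= v -> v < c + d' ->
    - (e * (v - u)) <= f v - f u \/ `]u, v] `<=` U.
  move=> /andP[ac cb]; have [Uc|Uc] := pselect (U c).
    have /nbhs_ballP[r /= r0 rU] : nbhs c U by exact: open_nbhs_nbhs.
    exists r => // u v cu uc cv vc; right => x /=; rewrite in_itv/= => /andP[ux xv].
    by apply: rU; rewrite /ball/= ltr_norml; lra.
  have Nc : ~ N' c by move=> /N'U.
  have acb : a < c < b.
    rewrite !lt_neqAle ac cb !andbT; apply/andP; split; apply/eqP => E; apply: Nc; right.
      by left.
    by right.
  have [l fl l0] : exists2 l, is_derive c 1 f l & 0 <= l.
    apply: contrapT => nl; apply: Nc; left; apply: NP => /= H; apply: nl; exact: H.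
  have [r r0 H] := is_derive_ge0_local fl l0 e0.
  by exists r => // u v *; left; exact: H.
have supS : has_sup S by split; [exists a|exists b => x [/andP[]]].
(* A single local step from a point of [S] near [c] passes beyond [c], so the supremum must be [b]
   and belongs to [S]. *)
set c := sup S.
have ac : a <= c by apply: sup_upper_bound.
have cb : c <= b by apply: sup_le_ub; [exists a|move=> x [/andP[]]].
have [|r r0 H] := Sloc c; first by rewrite ac.
have [u Su cu] := sup_adherent r0 supS.
have uc : u <= c by apply: sup_upper_bound.
have {}Sstep v : c <= v -> v <= b -> v < c + r -> S v.
  by move=> cv vb vr; apply: (Sstep u) => //; [rewrite vb (le_trans uc)|exact: H].
have Sb : S b.
  have [//|bcr] := ltP b (c + r); first by move=> ?; apply: Sstep.
  have : S (c + r / 2) by apply: Sstep; lra.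
  move=> /(sup_upper_bound supS); rewrite -/c; lra.
have [_ [s [sab pws ms fs]]] := Sb.
have : \sum_(p <- s) `|f p.2 - f p.1| < e.
  apply: acd => //; rewrite -lte_fin (le_lt_trans ms)// (le_lt_trans _ Ud)//.
  by rewrite le_measure ?inE//; exact: measurableI.
lra.
Qed.

End Monotonicity.

(** * Primitives of nonnegative integrable functions *)

Section Primitive.
Context {R : realType}.
Local Notation mu := (@lebesgue_measure R).
Implicit Types (f g : R -> R).

(** Keeps an explicit formula for the derivative next to the function, so that differential
    inequalities can be checked on formulas. *)
Definition AC_derive f g := locAC f /\
  {ae mu, forall x : R, 0 < x -> is_derive x 1 f (g x)}.

(** Absolute continuity of the Lebesgue integral: the increments add up to the integral over a
    disjoint union of half-open intervals of small measure. *)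
Lemma primitive_locAC f : (forall x, 0 <= f x) -> mu.-integrable setT (EFin \o f) ->
  locAC (fun x => \int[mu]_(t in `[0, x]) f t).
Proof.
move=> f0 intf b b0 e e0.
have intfS D : measurable D -> mu.-integrable D (EFin \o f).
  by move=> mD; apply: integrableS intf.
have [d [d0 H]] := integral_normr_continuous intf e0.
exists d => // n u v uv dis sd.
pose F i : set (measurableTypeR R) := `]u i, v i]%classic.
have trF : trivIset setT F.
  apply/trivIsetP => i j _ _ ij; rewrite -subset0 => x [].
  rewrite /F /= !in_itv/= => /andP[ux xv] /andP[ux' xv'].
  by exfalso; case: (dis _ _ ij) => ?; lra.
pose D := \big[setU/set0]_(i < n) F i.
have mF i : measurable (F i) by exact: measurable_itv.
have mD : measurable D by exact: bigsetU_measurable.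
have muD : (mu D < d%:E)%E.
  rewrite /D measure_bigsetU_ord//.
  rewrite (_ : (\sum_(i < n | _) _)%E = (\sum_(i < n) (v i - u i))%:E) ?lte_fin//.
  rewrite -sumEFin; apply: eq_bigr => i _; rewrite /F [LHS]lebesgue_measure_itv/= lte_fin.
  have [_ [ui _]] := uv i.
  case: ltP => // vu; congr EFin.
  by have -> : v i = u i; [apply/le_anti; rewrite ui vu|rewrite subrr].
have {}H := H _ mD muD; apply: le_lt_trans H.
rewrite le_eqVlt; apply/orP; left; apply/eqP.
rewrite (@eq_Rintegral _ _ _ mu D f) => [|x _]; last by rewrite ger0_norm.
rewrite /Rintegral /D ge0_integral_bigsetU//.
- rewrite -sum_fine; last first.
    move=> i _; exact: (integrable_fin_num (mF i) (intfS _ (mF i))).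
  apply: eq_bigr => i _; have [ui [uvi _]] := uv i.
  have -> : fine (\int[mu]_(t in `[0, v i]) (f t)%:E) -
      fine (\int[mu]_(t in `[0, u i]) (f t)%:E) = \int[mu]_(t in F i) f t.
    by apply: Rintegral_itvB; rewrite ?bnd_simp//; exact: intfS.
  by rewrite ger0_norm// Rintegral_ge0.
- exact: index_enum_uniq.
- exact: sub_trivIset trF.
- exact: (measurable_int mu (intfS _ mD)).
- by move=> x _; rewrite lee_fin.
Qed.

(** [P] integrates the extension of [f] by zero over [[0, x]]. Lebesgue differentiation gives its
    derivative, and convergence of the integrals over [[0, n]] gives the tail estimate. *)
Lemma primitive_AC_derive f : (forall x : R, 0 <= x -> 0 <= f x) ->
  mu.-integrable (`[0, +oo[ : set R) (EFin \o f) ->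
  let I := fine (\int[mu]_(x in (`[0%R, +oo[ : set R)) (f x)%:E)%E in
  exists P, [/\ AC_derive P f, P 0 = 0, (forall x, P x <= I) &
    forall e : R, 0 < e -> exists2 a : R, 0 <= a & forall x, a <= x -> I - e <= P x].
Proof.
move=> f0 intf I.
pose g : R -> R := f \_ `[0, +oo[.
have g0 x : 0 <= g x.
  rewrite /g patchE; case: ifPn => // /set_mem /=.
  by rewrite in_itv/= andbT; exact: f0.
have gE x : 0 <= x -> g x = f x.
  by move=> x0; rewrite /g patchE ifT// inE/= in_itv/= x0.
have intg : mu.-integrable setT (EFin \o g).
  by rewrite /g -restrict_EFin; apply/integrable_restrict => //; rewrite setTI.
have intgS (D : set R) : measurable D -> mu.-integrable D (EFin \o g).
  by move=> mD; apply: integrableS intg.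
have mg : measurable_fun setT g by apply/measurable_EFinP; exact: measurable_int intg.
have IE : (\int[mu]_(x in (`[0%R, +oo[ : set R)) (g x)%:E = I%:E)%E.
  rewrite /I fineK; last by apply: integrable_fin_num.
  by apply: eq_integral => x; rewrite inE/= in_itv/= andbT => /gE ->.
pose P x := \int[mu]_(t in `[0, x]) g t.
have PE x : (P x)%:E = (\int[mu]_(t in `[0%R, x]) (g t)%:E)%E.
  by rewrite /P /Rintegral fineK//; apply: integrable_fin_num => //; exact: intgS.
exists P; split.
- split; first exact: primitive_locAC.
  have : locally_integrable setT g.
    by apply: open_integrable_locally => //; exact: openT.
  move=> /(@FTC1 R g (BLeft 0) (fun y => intgS _ (measurable_itv _))).
  apply: filterS; first exact: (ae_filter_ringOfSetsType mu).
  move=> x H x0; have [|dP dPE] := H; first by rewrite /= lte_fin.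
  split; first exact: dP.
  by rewrite -(gE x (ltW x0)) -dPE derive1E.
- by rewrite /P set_itv1 Rintegral_set1.
- move=> x; rewrite -lee_fin PE -IE; apply: ge0_subset_integral => //=.
  + by apply/measurable_EFinP; exact: measurable_funTS.
  + by move=> ? _; rewrite lee_fin.
  + exact: subset_itvl.
- move=> e e0; have := @ge0_cvgn_integral R mu g g0 mg; rewrite IE.
  move=> /fine_cvgP[_ /cvgrPdist_lt /(_ e e0)] [N _ /(_ N (leqnn N)) /= HN].
  exists N%:R => // x Nx; apply: (@le_trans _ _ (P N%:R)).
    move: HN; rewrite -[fine _]/(P N%:R) => /(le_lt_trans (ler_norm _)) ; lra.
  rewrite -lee_fin !PE; apply: ge0_subset_integral => //=.
  + by apply/measurable_EFinP; exact: measurable_funTS.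
  + by move=> ? _; rewrite lee_fin.
  + by apply: subset_itvl; rewrite bnd_simp.
Qed.

End Primitive.

(** * Calculus rules, comparison and Gronwall's inequality *)

Section Calculus.
Context {R : realType}.
Local Notation mu := (@lebesgue_measure R).
Implicit Types (f g h F G : R -> R) (a b c : R).

Lemma ae_imply (P Q : R -> Prop) : (forall x, P x -> Q x) ->
  {ae mu, forall x, P x} -> {ae mu, forall x, Q x}.
Proof. by move=> PQ; apply: filterS => //; exact: (ae_filter_ringOfSetsType mu). Qed.

Lemma ae_imply2 (P Q S : R -> Prop) : (forall x, P x -> Q x -> S x) ->
  {ae mu, forall x, P x} -> {ae mu, forall x, Q x} -> {ae mu, forall x, S x}.
Proof. by move=> PQS; apply: filterS2 => //; exact: (ae_filter_ringOfSetsType mu). Qed.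

Lemma eq_AC_derive f g F G : AC_derive F G -> f =1 F ->
  (forall x, 0 < x -> g x = G x) -> AC_derive f g.
Proof.
move=> [acF dF] /funext -> gG; split=> //.
by apply: ae_imply dF => x dF x0; rewrite gG//; exact: dF.
Qed.

Lemma AC_derive_cst c : AC_derive (fun=> c) (fun=> 0).
Proof.
split; first exact: locAC_cst.
by apply: aeW => x _; exact: is_derive_cst.
Qed.

Lemma AC_derive_id : AC_derive (@id R) (fun=> 1).
Proof.
split; first exact: locAC_id.
by apply: aeW => x _; exact: is_derive_id.
Qed.

Lemma AC_deriveD f g F G : AC_derive F f -> AC_derive G g ->
  AC_derive (fun x => F x + G x) (fun x => f x + g x).
Proof.
move=> [acF dF] [acG dG]; split; first exact: locACD.
apply: ae_imply2 dF dG => x dF dG x0.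
by have := dF x0; have := dG x0 => dGx dFx; exact: is_deriveD.
Qed.

Lemma AC_deriveM f g F G : AC_derive F f -> AC_derive G g ->
  AC_derive (fun x => F x * G x) (fun x => f x * G x + F x * g x).
Proof.
move=> [acF dF] [acG dG]; split; first exact: locACM.
apply: ae_imply2 dF dG => x dF dG x0.
have := dF x0; have := dG x0 => dGx dFx.
suff <- : F x *: g x + G x *: f x = f x * G x + F x * g x by exact: is_deriveM.
by rewrite addrC /GRing.scale /= (mulrC (G x)).
Qed.

Lemma AC_deriveZ f F c : AC_derive F f ->
  AC_derive (fun x => c * F x) (fun x => c * f x).
Proof.
move=> dF; apply: (eq_AC_derive (AC_deriveM (AC_derive_cst c) dF)) => // x _.
by rewrite mul0r add0r.
Qed.

Lemma AC_deriveB f g F G : AC_derive F f -> AC_derive G g ->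
  AC_derive (fun x => F x - G x) (fun x => f x - g x).
Proof.
move=> dF dG; apply: (eq_AC_derive (AC_deriveD dF (AC_deriveZ (-1) dG))) => x *; ring.
Qed.

Lemma AC_derive_sqr f F : AC_derive F f ->
  AC_derive (fun x => F x ^+ 2) (fun x => 2 * (F x * f x)).
Proof.
move=> dF; apply: (eq_AC_derive (AC_deriveM dF dF)) => x *; ring.
Qed.

Lemma AC_derive_exp f F : AC_derive F f ->
  AC_derive (fun x => expR (F x)) (fun x => expR (F x) * f x).
Proof.
move=> [acF dF]; split; first exact: locAC_exp.
by apply: ae_imply dF => x /[apply] dFx; exact: is_derive1_comp.
Qed.

Lemma AC_derive_ge0 f F a b : AC_derive F f -> 0 <= a -> a <= b ->
  (forall x, a < x -> x < b -> 0 <= f x) -> F a <= F b.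
Proof.
move=> [acF dF] a0; rewrite le_eqVlt => /predU1P[->//|ab f0].
have acab : AC_on F a b.
  have b0 : 0 < b by lra.
  move=> e e0; have [d d0 H] := acF b b0 e e0; exists d => // n u v uv.
  by apply: H => i; have [? [? ?]] := uv i; split => //; lra.
apply: (AC_on_le (ltW ab) acab); apply: ae_imply dF => x dFx /andP[ax xb].
by exists (f x); [apply: dFx; lra|exact: f0].
Qed.

(** Takes the place of integrating [f <= g] over [[a, b]]. *)
Lemma AC_derive_le f g F G a b : AC_derive F f -> AC_derive G g ->
  0 <= a -> a <= b -> (forall x, a < x -> x < b -> f x <= g x) ->
  F b - F a <= G b - G a.
Proof.
move=> dF dG a0 ab fg; suff : G a - F a <= G b - F b by lra.
by apply: (AC_derive_ge0 (AC_deriveB dG dF)) => // x ax xb; rewrite subr_ge0 fg.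
Qed.

Lemma AC_derive_dist_le f g F G a b : AC_derive F f -> AC_derive G g ->
  0 <= a -> a <= b -> (forall x, a < x -> x < b -> `|f x| <= g x) ->
  `|F b - F a| <= G b - G a.
Proof.
move=> dF dG a0 ab fg; rewrite ler_norml; apply/andP; split; last first.
  by apply: (AC_derive_le dF dG) => // x ax xb; rewrite (le_trans (ler_norm _))// fg.
have : (-1 * F b) - (-1 * F a) <= G b - G a; last lra.
apply: (AC_derive_le (AC_deriveZ (-1) dF) dG) => // x ax xb.
by rewrite (le_trans (ler_norm _))// normrM normrN1 mul1r fg.
Qed.

(** The derivative of [F * expR (- G)] is nonpositive. *)
Lemma gronwall f F g G a b : AC_derive F f -> AC_derive G g ->
  0 <= a -> a <= b -> (forall x, a < x -> x < b -> f x <= g x * F x) ->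
  F b <= F a * expR (G b - G a).
Proof.
move=> dF dG a0 ab fg.
have dE := AC_deriveM dF (AC_derive_exp (AC_deriveZ (-1) dG)).
have := AC_derive_le dE (AC_derive_cst 0) a0 ab; rewrite subrr => H.
have {H} : F b * expR (-1 * G b) - F a * expR (-1 * G a) <= 0.
  apply: H => x ax xb /=.
  have -> : f x * expR (-1 * G x) + F x * (expR (-1 * G x) * (-1 * g x)) =
    (f x - g x * F x) * expR (-1 * G x) by ring.
  by rewrite mulr_le0_ge0 ?expR_ge0// subr_le0 fg.
rewrite subr_le0 !mulN1r !expRN ler_pdivrMr ?expR_gt0// => /le_trans; apply.
by rewrite expRB -mulrA (mulrC _^-1).
Qed.

End Calculus.

(** * Growth of solutions, and their behaviour beyond the turning point *)

Section Solutions.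
Context {R : realType}.
Implicit Types (q Q phi p N : R -> R) (lam I J a b x : R).

(** [I] stands for the total integral, but only the upper bound is required; that [P] approaches it
    is assumed where it matters. *)
Definition bounded_primitive (f P : R -> R) I :=
  [/\ AC_derive P f, P 0 = 0 & forall x, P x <= I].

Definition is_solution q lam phi p :=
  [/\ AC_derive phi p, AC_derive p (fun x => (x - lam + q x) * phi x) & phi 0 = 0].

Lemma bounded_primitive_bounds f P I x : bounded_primitive f P I ->
  (forall x, 0 <= f x) -> 0 <= x -> 0 <= P x <= I.
Proof.
move=> [dP P0 PI] f0 x0; rewrite PI andbT -P0.
exact: AC_derive_ge0 dP _ _ _.
Qed.

Lemma norm_mul2_le_sqrD (x y : R) : `|2 * (x * y)| <= x ^+ 2 + y ^+ 2.
Proof.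
rewrite ler_norml; have := sqr_ge0 (x + y); have := sqr_ge0 (x - y).
rewrite sqrrB sqrrD; lra.
Qed.

(** Gronwall: the derivative is [(1 + x - lam + q x) * (2 * (phi x * p x))], whose last factor is
    bounded by [phi x ^+ 2 + p x ^+ 2]. *)
Lemma energy_growth q Q I lam phi p a b C :
  bounded_primitive (fun x => `|q x|) Q I -> is_solution q lam phi p ->
  0 <= a -> a <= b -> (forall x, a < x -> x < b -> `|1 + x - lam| <= C) ->
  phi b ^+ 2 + p b ^+ 2 <=
    (phi a ^+ 2 + p a ^+ 2) * expR (C * (b - a) + (Q b - Q a)).
Proof.
move=> [dQ _ _] [dphi dp _] a0 ab HC.
have dF := AC_deriveD (AC_derive_sqr dphi) (AC_derive_sqr dp).
have dG := AC_deriveD (AC_deriveZ C (@AC_derive_id R)) dQ.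
have := gronwall dF dG a0 ab.
rewrite (_ : C * b + Q b - (C * a + Q a) = C * (b - a) + (Q b - Q a)); last by ring.
apply=> x ax xb.
have -> : 2 * (phi x * p x) + 2 * (p x * ((x - lam + q x) * phi x)) =
  (1 + x - lam + q x) * (2 * (phi x * p x)) by ring.
rewrite (le_trans (ler_norm _))// normrM ler_pM//; last exact: norm_mul2_le_sqrD.
by rewrite (le_trans (ler_normD _ _))// mulr1 lerD2r HC.
Qed.

Lemma energy_bound q Q I lam phi p b C :
  bounded_primitive (fun x => `|q x|) Q I -> is_solution q lam phi p ->
  p 0 = 1 -> 0 <= b -> 1 + b + `|lam| <= C ->
  phi b ^+ 2 + p b ^+ 2 <= expR (C * b + I).
Proof.
move=> HQ Hs p0 b0 HC; have [_ Q0 QI] := HQ; have [_ _ phi0] := Hs.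
have := energy_growth HQ Hs (lexx 0) b0 (C := C).
rewrite phi0 p0 expr0n/= add0r expr1n mul1r Q0 !subr0 => H.
apply: le_trans (H _) _; last by rewrite ler_expR lerD2l.
move=> x x0 xb; rewrite (le_trans (ler_normB _ _))// ger0_norm; lra.
Qed.

(** Uniqueness for zero initial data, by which a nonzero eigenfunction has nonzero slope at 0. *)
Lemma solution_eq0 q Q I lam phi p :
  bounded_primitive (fun x => `|q x|) Q I -> is_solution q lam phi p ->
  p 0 = 0 -> forall x, 0 <= x -> phi x = 0.
Proof.
move=> HQ Hs p0 b b0; have [_ _ phi0] := Hs.
have := energy_growth HQ Hs (lexx 0) b0 (C := 1 + b + `|lam|).
rewrite phi0 p0 expr0n/= addr0 mul0r => H.
have {H} : phi b ^+ 2 + p b ^+ 2 <= 0.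
  by apply: H => x x0 xb; rewrite (le_trans (ler_normB _ _))// ger0_norm; lra.
have := sqr_ge0 (phi b); have := sqr_ge0 (p b) => H1 H2 H3.
by apply/eqP; rewrite -sqrf_eq0; apply/eqP; lra.
Qed.

Lemma solutionZ q lam phi p c : is_solution q lam phi p ->
  is_solution q lam (fun x => c * phi x) (fun x => c * p x).
Proof.
move=> [dphi dp phi0]; split; last by rewrite phi0 mulr0.
  exact: AC_deriveZ.
by apply: (eq_AC_derive (AC_deriveZ c dp)) => // x _; ring.
Qed.

(* The correction by the tail r = Q - I of the primitive of |q| absorbs the
   q-term of (phi p)' = p^2 + (x - lam + q) phi^2. *)
Definition flux (Q phi p : R -> R) I x := phi x * p x + (Q x - I) * phi x ^+ 2.

(** The point [a] is at least 1 beyond the turning point and leaves at most 1/2 of the mass of [|q|]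
    to its right. *)
Definition tail_start q Q I lam a := [/\ bounded_primitive (fun x => `|q x|) Q I,
  0 <= a, lam + 1 <= a & forall x, a <= x -> I - 2^-1 <= Q x].

(** The correction contributes [|q| * phi ^+ 2], which makes the [q] term nonnegative. The cross
    term [2 * (Q - I) * phi * p] is at most half the weight, because [I - Q <= 1/2] and
    [x - lam >= 1]. *)
Lemma flux_derive_ge q Q I lam a phi p : tail_start q Q I lam a ->
  is_solution q lam phi p ->
  exists2 h, AC_derive (flux Q phi p I) h &
    forall x, a < x -> p x ^+ 2 + (x - lam) * phi x ^+ 2 <= 2 * h x.
Proof.
move=> [[dQ _ QI] a0 la Qa] [dphi dp _].
have := AC_deriveD (AC_deriveM dphi dp)
  (AC_deriveM (AC_deriveB dQ (AC_derive_cst I)) (AC_derive_sqr dphi)).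
set h := (X in AC_derive _ X) => dh; exists h => [|x ax]; first exact: dh.
rewrite /h; have {Qa} := Qa x (ltW ax); have {QI} := QI x.
set r := Q x - I => QI Qa.
have r0 : 0 <= - r by rewrite /r; lra.
have r1 : 0 <= r + 2^-1 by rewrite /r; lra.
have : 0 <= (q x + `|q x|) * phi x ^+ 2.
  by rewrite mulr_ge0 ?sqr_ge0// -lerBlDl sub0r -normrN ler_norm.
have H0 : 0 <= (x - lam - 1) * phi x ^+ 2 by rewrite mulr_ge0 ?sqr_ge0//; lra.
have := norm_mul2_le_sqrD (phi x) (p x); rewrite ler_norml => /andP[H1 H2].
have : 0 <= - r * (phi x ^+ 2 + p x ^+ 2 - 2 * (phi x * p x)).
  by rewrite mulr_ge0//; lra.
have : 0 <= (r + 2^-1) * (phi x ^+ 2 + p x ^+ 2).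
  by rewrite mulr_ge0// addr_ge0 ?sqr_ge0.
move: (phi x) (p x) (q x) `|q x| r (x - lam) {H1 H2 QI Qa r0 r1} H0.
move=> u w t t' r z; nra.
Qed.

Lemma weight_ge0 lam phi p x : lam <= x -> 0 <= p x ^+ 2 + (x - lam) * phi x ^+ 2.
Proof. by move=> lx; rewrite addr_ge0 ?sqr_ge0// mulr_ge0 ?sqr_ge0 ?subr_ge0. Qed.

Lemma flux_nondecreasing q Q I lam a phi p x y : tail_start q Q I lam a ->
  is_solution q lam phi p -> a <= x -> x <= y ->
  flux Q phi p I x <= flux Q phi p I y.
Proof.
move=> Ht Hs ax xy; have [_ a0 la _] := Ht.
have [h dh hW] := flux_derive_ge Ht Hs.
apply: (AC_derive_ge0 dh) => //; first lra.
move=> z xz zy; have := hW z (le_lt_trans ax xz).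
have := @weight_ge0 lam phi p z; lra.
Qed.

(** The flux is at most [phi * p], half the derivative of [phi ^+ 2]. A positive value would persist
    by monotonicity and make [phi ^+ 2] grow linearly, against the bound on [N]. *)
Lemma flux_le0 q Q I lam a phi p N J x : tail_start q Q I lam a ->
  is_solution q lam phi p -> bounded_primitive (fun x => phi x ^+ 2) N J ->
  a <= x -> flux Q phi p I x <= 0.
Proof.
move=> Ht Hs HN ax; have [[dQ Q0 QI] a0 la _] := Ht; have [dphi _ _] := Hs.
have [dN N0 NJ] := HN.
rewrite leNgt; apply/negP => Hx; set e := flux Q phi p I x in Hx.
have x0 : 0 <= x by lra.
have phige t : x <= t -> 2 * e * (t - x) <= phi t ^+ 2.
  move=> xt; have d1 := AC_deriveZ (2 * e) (@AC_derive_id R).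
  have := AC_derive_le d1 (AC_derive_sqr dphi) x0 xt.
  move=> /= H; have {H} : 2 * e * t - 2 * e * x <= phi t ^+ 2 - phi x ^+ 2.
    apply: H => z xz zt; have := flux_nondecreasing Ht Hs ax (ltW xz).
    rewrite -/e /flux => ez; have := QI z => QIz.
    have : 0 <= (I - Q z) * phi z ^+ 2 by rewrite mulr_ge0 ?sqr_ge0//; lra.
    lra.
  have := sqr_ge0 (phi x); lra.
have J0 : 0 <= J by rewrite -(N0) NJ.
(* With this [s], [e * s ^+ 2 >= e * s = e + J] exceeds the possible increase of [N]. *)
pose s := 1 + J / e; have s1 : 1 <= s by rewrite lerDl divr_ge0// ltW.
have : e * s ^+ 2 <= N (x + s) - N x.
  have d2 := AC_deriveZ e (AC_derive_sqr (AC_deriveB (@AC_derive_id R) (AC_derive_cst x))).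
  have <- : e * (x + s - x) ^+ 2 - e * (x - x) ^+ 2 = e * s ^+ 2 by ring.
  apply: (AC_derive_le d2 dN) => //; first lra.
  by move=> z xz zs; have := phige z (ltW xz); lra.
have : e <= e * s by rewrite ler_peMr// ltW.
have : e * s <= e * s ^+ 2 by rewrite expr2 mulrA ler_peMr// mulr_ge0// ltW//; lra.
have : e * s = e + J by rewrite /s mulrDr mulr1 mulrCA divff ?mulr1// gt_eqF.
have := NJ (x + s); have : 0 <= N x.
  by have /andP[] := bounded_primitive_bounds HN (fun x => sqr_ge0 (phi x)) x0.
lra.
Qed.

Lemma flux_ge q Q I lam a phi p : tail_start q Q I lam a ->
  - (phi a ^+ 2 + p a ^+ 2) <= flux Q phi p I a.
Proof.
move=> [[_ _ QI] a0 la Qa]; rewrite /flux.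
have := norm_mul2_le_sqrD (phi a) (p a); rewrite ler_norml => /andP[H1 H2].
have := QI a; have := Qa a (lexx a) => h1 h2.
have : 0 <= (Q a - I + 2^-1) * phi a ^+ 2 by rewrite mulr_ge0 ?sqr_ge0//; lra.
have := sqr_ge0 (phi a); have := sqr_ge0 (p a); lra.
Qed.

(** The flux stays between its value at [a] and 0. As [2 * phi * p] is at most the weight, its
    increase also bounds [phi ^+ 2], and [phi * p] differs from the flux by at most half of
    [phi ^+ 2]. *)
Lemma tail_bound q Q I lam a phi p N J x : tail_start q Q I lam a ->
  is_solution q lam phi p -> bounded_primitive (fun x => phi x ^+ 2) N J ->
  a <= x -> `|phi x * p x| <= 3 * (phi a ^+ 2 + p a ^+ 2).
Proof.
move=> Ht Hs HN ax; have [[dQ Q0 QI] a0 la Qa] := Ht; have [dphi _ _] := Hs.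
have [h dh hW] := flux_derive_ge Ht Hs.
have Ha := flux_ge phi p Ht; have Hx := flux_le0 Ht Hs HN ax.
have Hax := flux_nondecreasing Ht Hs (lexx a) ax.
have H : phi x ^+ 2 - phi a ^+ 2 <= 2 * flux Q phi p I x - 2 * flux Q phi p I a.
  apply: (AC_derive_le (AC_derive_sqr dphi) (AC_deriveZ 2 dh)) => // z az zx.
  apply: le_trans (hW z az); have := norm_mul2_le_sqrD (phi z) (p z).
  rewrite ler_norml => /andP[_ H2].
  have : 0 <= (z - lam - 1) * phi z ^+ 2 by rewrite mulr_ge0 ?sqr_ge0//; lra.
  lra.
have := QI x; have := Qa x ax => h1 h2.
have K1 : 0 <= (Q x - I + 2^-1) * phi x ^+ 2 by rewrite mulr_ge0 ?sqr_ge0//; lra.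
have K2 : 0 <= (I - Q x) * phi x ^+ 2 by rewrite mulr_ge0 ?sqr_ge0//; lra.
have := sqr_ge0 (p a); have := sqr_ge0 (phi a).
rewrite ler_norml; move: Hx Hax H; rewrite {1 2 4}/flux; lra.
Qed.

(** Right of [A] the weight dominates [(A - lam) * phi ^+ 2], and its integral is at most twice the
    increase of the flux. *)
Lemma tail_mass q Q I lam a phi p N J A b : tail_start q Q I lam a ->
  is_solution q lam phi p -> bounded_primitive (fun x => phi x ^+ 2) N J ->
  a <= A -> A <= b ->
  (A - lam) * (N b - N A) <= 2 * (phi a ^+ 2 + p a ^+ 2).
Proof.
move=> Ht Hs HN aA Ab; have [_ a0 la Qa] := Ht; have [dN _ _] := HN.
have [h dh hW] := flux_derive_ge Ht Hs.
have Ha := flux_ge phi p Ht; have Hb := flux_le0 Ht Hs HN (le_trans aA Ab).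
have HA := flux_nondecreasing Ht Hs (lexx a) aA.
have : (A - lam) * N b - (A - lam) * N A <=
    2 * flux Q phi p I b - 2 * flux Q phi p I A.
  apply: (AC_derive_le (AC_deriveZ _ dN) (AC_deriveZ 2 dh)) => //; first lra.
  move=> z Az zb; apply: le_trans (hW z (le_lt_trans aA Az)).
  have : 0 <= (z - A) * phi z ^+ 2 by rewrite mulr_ge0 ?sqr_ge0//; lra.
  have := sqr_ge0 (p z); lra.
lra.
Qed.

(** Supplies far points at which boundary terms are small, for two solutions at once: the sum of the
    weights has bounded integral, so it cannot stay above [d]. *)
Lemma small_weights q Q I a lam1 phi1 p1 N1 J1 lam2 phi2 p2 N2 J2 :
  tail_start q Q I lam1 a -> is_solution q lam1 phi1 p1 ->
  bounded_primitive (fun x => phi1 x ^+ 2) N1 J1 ->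
  tail_start q Q I lam2 a -> is_solution q lam2 phi2 p2 ->
  bounded_primitive (fun x => phi2 x ^+ 2) N2 J2 ->
  forall d B, 0 < d -> exists2 b, a <= b /\ B <= b &
    (p1 b ^+ 2 + (b - lam1) * phi1 b ^+ 2) +
    (p2 b ^+ 2 + (b - lam2) * phi2 b ^+ 2) < d.
Proof.
move=> Ht1 Hs1 HN1 Ht2 Hs2 HN2 d B d0; have [_ a0 _ _] := Ht1.
apply: contrapT => nex.
have {}nex b : a <= b -> B <= b -> d <=
    (p1 b ^+ 2 + (b - lam1) * phi1 b ^+ 2) + (p2 b ^+ 2 + (b - lam2) * phi2 b ^+ 2).
  by move=> ab Bb; rewrite leNgt; apply/negP => H; apply: nex; exists b.
have [h1 dh1 hW1] := flux_derive_ge Ht1 Hs1.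
have [h2 dh2 hW2] := flux_derive_ge Ht2 Hs2.
have Ha1 := flux_ge phi1 p1 Ht1; have Ha2 := flux_ge phi2 p2 Ht2.
set M1 := phi1 a ^+ 2 + _ in Ha1; set M2 := phi2 a ^+ 2 + _ in Ha2.
have M10 : 0 <= M1 by rewrite addr_ge0 ?sqr_ge0.
have M20 : 0 <= M2 by rewrite addr_ge0 ?sqr_ge0.
(* [d * (b - c)] is made larger than [2 * (M1 + M2)], the most that twice the two fluxes can
   gain. *)
pose c := Num.max a B; pose b := c + 2 * (M1 + M2 + 1) / d.
have ac : a <= c by rewrite le_max lexx.
have Bc : B <= c by rewrite le_max lexx orbT.
have cb : c <= b by rewrite lerDl divr_ge0// ?(ltW d0)//; lra.
have Hc1 := flux_nondecreasing Ht1 Hs1 (lexx a) ac.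
have Hc2 := flux_nondecreasing Ht2 Hs2 (lexx a) ac.
have Hb1 := flux_le0 Ht1 Hs1 HN1 (le_trans ac cb).
have Hb2 := flux_le0 Ht2 Hs2 HN2 (le_trans ac cb).
have : d * b - d * c <= 2 * (flux Q phi1 p1 I b + flux Q phi2 p2 I b) -
    2 * (flux Q phi1 p1 I c + flux Q phi2 p2 I c).
  apply: (AC_derive_le (AC_deriveZ d (@AC_derive_id R))
    (AC_deriveZ 2 (AC_deriveD dh1 dh2))) => //; first lra.
  move=> z cz zb; have := hW1 z (le_lt_trans ac cz).
  have := hW2 z (le_lt_trans ac cz); have := nex z; lra.
have : d * b - d * c = 2 * (M1 + M2 + 1).
  by rewrite /b mulrDr addrAC subrr add0r mulrCA divff ?mulr1// gt_eqF.
lra.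
Qed.

End Solutions.

(** * The squared norm of the solution with unit slope at 0, for large [lam] *)

Section NormingConstant.
Context {R : realType}.
Implicit Types (q Q phi p N : R -> R) (lam I J a b x : R).

(** The derivative is [2 * q * phi * p - phi ^+ 2], and [phi ^+ 2 + p ^+ 2] is at most the energy
    while [lam - x >= 1]. Gronwall then costs only the mass of [|q|], whatever [lam] is. *)
Lemma energy_turning q Q I lam phi p x :
  bounded_primitive (fun x => `|q x|) Q I -> is_solution q lam phi p ->
  p 0 = 1 -> 0 <= x -> x <= lam - 1 ->
  p x ^+ 2 + (lam - x) * phi x ^+ 2 <= expR I.
Proof.
move=> [dQ Q0 QI] [dphi dp phi0] p0 x0 xl.
have dE := AC_deriveD (AC_derive_sqr dp)
  (AC_deriveM (AC_deriveB (AC_derive_cst lam) (@AC_derive_id R)) (AC_derive_sqr dphi)).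
have := gronwall dE dQ (lexx 0) x0.
rewrite p0 phi0 Q0 expr1n expr0n/= mulr0 addr0 subr0 mul1r => H.
apply: le_trans (H _) _; last by rewrite ler_expR.
move=> y y0 yx.
have -> : 2 * (p y * ((y - lam + q y) * phi y)) +
    ((0 - 1) * phi y ^+ 2 + (lam - y) * (2 * (phi y * p y))) =
    q y * (2 * (phi y * p y)) - phi y ^+ 2 by ring.
apply: (@le_trans _ _ (`|q y| * (phi y ^+ 2 + p y ^+ 2))).
  have : q y * (2 * (phi y * p y)) <= `|q y| * (phi y ^+ 2 + p y ^+ 2).
    by rewrite (le_trans (ler_norm _))// normrM ler_wpM2l// norm_mul2_le_sqrD.
  have := sqr_ge0 (phi y); lra.
rewrite ler_wpM2l//.
have : 0 <= (lam - y - 1) * phi y ^+ 2 by rewrite mulr_ge0 ?sqr_ge0//; lra.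
lra.
Qed.

(** Up to [lam - 1] the energy gives [expR I]; the turning zone of length 2, where
    [|1 + x - lam| <= 2], adds [4 + I] to the exponent; beyond it [tail_bound] costs the factor
    3. *)
Lemma solution_prod_bound q Q I lam phi p N J x :
  tail_start q Q I lam (lam + 1) -> is_solution q lam phi p ->
  bounded_primitive (fun x => phi x ^+ 2) N J ->
  p 0 = 1 -> 1 <= lam -> 0 <= x -> `|phi x * p x| <= 3 * expR (4 + 2 * I).
Proof.
move=> Ht Hs HN p0 l1 x0; have [HQ _ _ _] := Ht.
have QI (y : R) : 0 <= y -> 0 <= Q y <= I.
  by move=> y0; apply: (bounded_primitive_bounds HQ) => // z; exact: normr_ge0.
have I0 : 0 <= I by have := QI 0 (lexx 0); lra.
have l0 : 0 <= lam - 1 by lra.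
have half (y z : R) : `|y * z| <= y ^+ 2 + z ^+ 2.
  have := norm_mul2_le_sqrD y z; rewrite normrM (ger0_norm (ler0n _ 2)).
  have := normr_ge0 (y * z); lra.
have le4 : expR I <= expR (4 + 2 * I) by rewrite ler_expR; lra.
have mid y : lam - 1 <= y -> y <= lam + 1 -> phi y ^+ 2 + p y ^+ 2 <= expR (4 + 2 * I).
  move=> ly yl; have := energy_growth HQ Hs l0 ly (C := 2) => H.
  apply: (@le_trans _ _ (expR I * expR (4 + I))); last by rewrite -expRD ler_expR; lra.
  apply: le_trans (H _) _ => [z zl zy|]; first by rewrite ler_norml; lra.
  have y0 : 0 <= y by lra.
  apply: ler_pM; rewrite ?expR_ge0 ?addr_ge0 ?sqr_ge0//.
    have := energy_turning HQ Hs p0 l0 (lexx _).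
    have -> : lam - (lam - 1) = 1 by ring.
    lra.
  rewrite ler_expR; have := QI y y0; have := QI (lam - 1) l0; lra.
have [xl|lx] := leP x (lam - 1).
  apply: le_trans (half _ _) _.
  have := energy_turning HQ Hs p0 x0 xl.
  have : 0 <= (lam - x - 1) * phi x ^+ 2 by rewrite mulr_ge0 ?sqr_ge0//; lra.
  have := expR_ge0 I; lra.
have [xl|xl] := leP x (lam + 1).
  apply: le_trans (half _ _) _.
  by have := mid x (ltW lx) xl; have := expR_ge0 (4 + 2 * I); lra.
apply: le_trans (tail_bound Ht Hs HN (ltW xl)) _.
by rewrite ler_wpM2l//; apply: mid; lra.
Qed.

(* Integrates (p^2 + (lam - x) phi^2 + N)' = 2 q phi p separately over [0, M],
   where |phi p| = O(1/s), and over [M, oo[, where |q| has small mass. *)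
Lemma norming_estimate q Q I lam phi p N J M s e :
  bounded_primitive (fun x => `|q x|) Q I ->
  is_solution q lam phi p -> bounded_primitive (fun x => phi x ^+ 2) N J ->
  (forall d, 0 < d -> exists2 b, 0 <= b & forall x, b <= x -> J - d <= N x) ->
  p 0 = 1 -> 1 <= s -> 0 <= M -> M + s ^+ 2 <= lam ->
  e <= 2^-1 -> (forall x, M <= x -> I - e <= Q x) ->
  `|J - 1| <= expR I * I / s + 6 * expR (4 + 2 * I) * e.
Proof.
move=> HQ Hs HN NJ p0 s1 M0 Ml e2 QM.
have [dQ Q0 QI] := HQ; have [dphi dp phi0] := Hs; have [dN N0 NleJ] := HN.
have s21 : 1 <= s ^+ 2 by rewrite expr_ge1//; lra.
have l1 : 1 <= lam by lra.
have Ht : tail_start q Q I lam (lam + 1).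
  by split => //; [lra|move=> x lx; have := QM x; lra].
set B := 3 * expR (4 + 2 * I).
have s0 : 0 < s by lra.
have I0 : 0 <= I by rewrite -Q0 QI.
(* Starts at 1 and is close to [J] at far points where the weight is small. *)
pose D x := p x ^+ 2 + (lam - x) * phi x ^+ 2 + N x.
have dD : AC_derive D (fun x => q x * (2 * (phi x * p x))).
  apply: (eq_AC_derive (AC_deriveD (AC_deriveD (AC_derive_sqr dp)
    (AC_deriveM (AC_deriveB (AC_derive_cst lam) (@AC_derive_id R))
      (AC_derive_sqr dphi))) dN)) => // x _; ring.
have D0 : D 0 = 1 by rewrite /D p0 phi0 N0 expr1n expr0n/= mulr0 !addr0.
have DM : `|D M - 1| <= expR I / s * I.
  have := AC_derive_dist_le dD (AC_deriveZ (expR I / s) dQ) (lexx 0) M0.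
  rewrite D0 Q0 mulr0 subr0 => H; apply: le_trans (H _) _; last first.
    by rewrite ler_wpM2l// divr_ge0 ?expR_ge0// ltW.
  move=> x x0 xM; rewrite normrM mulrC ler_wpM2r// ler_pdivlMr//.
  rewrite -(ger0_norm (ltW s0)) -normrM.
  (* The factor [s] goes to [phi], since [s ^+ 2 * phi ^+ 2] is dominated by the energy:
     [lam - x >= s ^+ 2] on [[0, M]]. *)
  have -> : 2 * (phi x * p x) * s = 2 * ((s * phi x) * p x) by ring.
  apply: le_trans (norm_mul2_le_sqrD _ _) _.
  have xl : x <= lam - 1 by lra.
  have := energy_turning HQ Hs p0 (ltW x0) xl.
  have : 0 <= (lam - x - s ^+ 2) * phi x ^+ 2 by rewrite mulr_ge0 ?sqr_ge0//; lra.
  by rewrite exprMn; lra.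
have B0 : 0 <= B by rewrite mulr_ge0// expR_ge0.
have DMb b : M <= b -> `|D b - D M| <= 2 * B * e.
  move=> Mb; have := AC_derive_dist_le dD (AC_deriveZ (2 * B) dQ) M0 Mb.
  move=> H; apply: le_trans (H _) _; last first.
    by rewrite -mulrBr ler_wpM2l ?mulr_ge0//; have := QI b; have := QM M (lexx M); lra.
  move=> x Mx xb; rewrite normrM mulrC ler_wpM2r// normrM (ger0_norm (ler0n _ 2)).
  rewrite ler_wpM2l//; apply: (solution_prod_bound Ht Hs HN p0 l1); lra.
have -> : 6 * expR (4 + 2 * I) * e = 2 * B * e by rewrite /B; ring.
apply/ler_addgt0Pr => d d0.
have d40 : 0 < d / 2 by rewrite divr_gt0.
have [b1 b10 Hb1] := NJ _ d40.
(* The same solution fills both slots, so the boundary terms of [D] at [b] stay below [d / 4], while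
   [N b] is within [d / 2] of [J]. *)
have [b [lb b1b] Wb] := small_weights Ht Hs HN Ht Hs HN b1 d40.
have Nb := Hb1 b b1b; have {}NJ := NleJ b.
have Mb : M <= b by lra.
have -> : expR I * I / s = expR I / s * I by rewrite mulrAC.
have := DMb b Mb; move: DM.
have W0 : 0 <= (b - lam) * phi b ^+ 2 by rewrite mulr_ge0 ?sqr_ge0//; lra.
have := sqr_ge0 (p b); rewrite {2}/D.
rewrite !ler_norml => H1 /andP[H2 H3] /andP[H4 H5]; apply/andP; split; lra.
Qed.

End NormingConstant.

(** * A uniform gap between eigenvalues in a bounded set *)

Section Discreteness.
Context {R : realType}.
Implicit Types (q Q phi p N : R -> R) (lam I J L a b c x : R).

(** Near 0 the slope stays above 1/2, so [phi x >= x / 2] on [[0, c]] and the mass there is at least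
    [c ^+ 3 / 12], with [c] independent of the solution. *)
Lemma mass_lower_bound q Q I L : bounded_primitive (fun x => `|q x|) Q I ->
  exists k, exists2 c, 0 < k /\ 0 <= c & forall lam phi p N J, `|lam| <= L ->
    is_solution q lam phi p -> p 0 = 1 ->
    bounded_primitive (fun x => phi x ^+ 2) N J -> k <= N c.
Proof.
move=> HQ; have [[acQ dQ] Q0 QI] := HQ.
have [L0|L0] := ltP L 0.
  exists 1, 0 => // lam phi p N J; have := normr_ge0 lam; lra.
pose M := 1 + expR (2 + L + I).
have M0 : 0 < M by rewrite addr_gt0// expR_gt0.
have e0 : 0 < (4 * M)^-1 by rewrite invr_gt0 mulr_gt0.
have [d d0 Hd] := AC_on_unif (acQ 1 ltr01) e0.
(* [(1 + L) * c] and [Q c] are at most [1 / (4 * M)], where [M] bounds [|phi|] on [[0, 1]]; hence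
   [p] moves by at most 1/2. *)
pose c := Num.min (Num.min 1 (d / 2)) ((4 * M)^-1 / (1 + L)).
have c0 : 0 < c by rewrite !lt_min ltr01 !divr_gt0//; lra.
have c1 : c <= 1 by rewrite !ge_min lexx.
have cd : c < d.
  have : c <= d / 2 by rewrite !ge_min lexx orbT.
  lra.
have cL : (1 + L) * c <= (4 * M)^-1.
  by rewrite mulrC -ler_pdivlMr ?ge_min ?lexx ?orbT//; lra.
exists (12^-1 * c ^+ 3), c; first by rewrite mulr_gt0 ?exprn_gt0//; split => //; lra.
move=> lam phi p N J lamL Hs p0 HN; have [dphi dp phi0] := Hs; have [dN N0 _] := HN.
have phiM x : 0 <= x -> x <= 1 -> `|phi x| <= M.
  move=> x0 x1; have Lx : 1 + x + `|lam| <= 2 + L by lra.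
  have := energy_bound HQ Hs p0 x0 Lx => H.
  have {H} : phi x ^+ 2 + p x ^+ 2 <= expR (2 + L + I).
    apply: le_trans H _; rewrite ler_expR lerD2r.
    have : 0 <= (2 + L) * (1 - x) by rewrite mulr_ge0//; lra.
    lra.
  rewrite /M -(real_normK (num_real (phi x))); have := sqr_ge0 (p x).
  have := sqr_ge0 (`|phi x| - 1); rewrite sqrrB; have := normr_ge0 (phi x); nra.
have pge x : 0 <= x -> x <= c -> 2^-1 <= p x.
  move=> x0 xc.
  have dG := AC_deriveZ M (AC_deriveD (AC_deriveZ (1 + L) (@AC_derive_id R)) (conj acQ dQ)).
  have : `|p x - p 0| <= M * ((1 + L) * x + Q x) - M * ((1 + L) * 0 + Q 0).
    apply: (AC_derive_dist_le dp dG (lexx 0) x0) => y y0 yx.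
    rewrite normrM mulrC ler_pM//; first by apply: phiM; lra.
    rewrite (le_trans (ler_normD _ _))// lerD2r mulr1.
    by rewrite (le_trans (ler_normB _ _))// ger0_norm; lra.
  rewrite p0 Q0 !(mulr0, addr0) subr0 ler_norml => /andP[H _].
  have Qx : Q x <= (4 * M)^-1.
    have := Hd 0 x (lexx 0) x0; rewrite Q0 !subr0 => H'.
    by apply/ltW/(le_lt_trans (ler_norm _)); apply: H'; lra.
  have Lx : (1 + L) * x <= (4 * M)^-1.
    by apply: le_trans cL; rewrite ler_wpM2l//; lra.
  have : M * ((1 + L) * x + Q x) <= M * (2 * (4 * M)^-1).
    by rewrite ler_wpM2l ?(ltW M0)//; lra.
  have -> : M * (2 * (4 * M)^-1) = 2^-1 by field; rewrite gt_eqF.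
  lra.
have phige x : 0 <= x -> x <= c -> 2^-1 * x <= phi x.
  move=> x0 xc; have := AC_derive_le (AC_deriveZ 2^-1 (@AC_derive_id R)) dphi (lexx 0) x0.
  rewrite /= phi0 mulr0 !subr0; apply => y y0 yx.
  by rewrite mulr1; apply: pge; lra.
have d3 : AC_derive (fun x => 12^-1 * x ^+ 3) (fun x => 4^-1 * x ^+ 2).
  by apply: (eq_AC_derive (AC_deriveZ 12^-1 (AC_deriveM (@AC_derive_id R)
    (AC_derive_sqr (@AC_derive_id R))))) => x *; field.
have := AC_derive_le d3 dN (lexx 0) (ltW c0).
rewrite N0 expr0n/= mulr0 !subr0; apply => x x0 xc.
have h := phige x (ltW x0) (ltW xc).
have -> : 4^-1 * x ^+ 2 = (2^-1 * x) ^+ 2 by field.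
by rewrite ler_pXn2r// nnegrE; lra.
Qed.

(** Gronwall for the squared distance of the two solutions plus a constant, [|lam2 - lam1|] times a
    bound for [phi2 ^+ 2], which absorbs the forcing term [(lam2 - lam1) * phi2]. *)
Lemma solution_close q Q I L A b lam1 phi1 p1 lam2 phi2 p2 :
  bounded_primitive (fun x => `|q x|) Q I ->
  `|lam1| <= L -> `|lam2| <= L -> `|lam2 - lam1| <= 1 ->
  is_solution q lam1 phi1 p1 -> p1 0 = 1 -> is_solution q lam2 phi2 p2 -> p2 0 = 1 ->
  0 <= b -> b <= A ->
  (phi1 b - phi2 b) ^+ 2 <=
    `|lam2 - lam1| * (expR ((1 + A + L) * A + I) * expR ((2 + A + L) * A + I)).
Proof.
move=> HQ l1 l2; set D := `|_ - _| => D1 Hs1 p10 Hs2 p20 b0 bA.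
set M := expR ((1 + A + L) * A + I); set C := 2 + A + L.
have [dQ Q0 QI] := HQ; have [dphi1 dp1 phi10] := Hs1; have [dphi2 dp2 phi20] := Hs2.
have D0 : 0 <= D by exact: normr_ge0.
have M0 : 0 <= M by exact: expR_ge0.
have L0 : 0 <= L by have := normr_ge0 lam1; lra.
have phi2M x : 0 <= x -> x <= A -> phi2 x ^+ 2 <= M.
  move=> x0 xA; have Lx : 1 + x + `|lam2| <= 1 + A + L by lra.
  have H := energy_bound HQ Hs2 p20 x0 Lx.
  have : phi2 x ^+ 2 + p2 x ^+ 2 <= M.
    apply: le_trans H _; rewrite ler_expR lerD2r ler_wpM2l//; lra.
  have := sqr_ge0 (p2 x); lra.
have dF := AC_deriveD (AC_deriveD (AC_derive_sqr (AC_deriveB dphi1 dphi2))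
  (AC_derive_sqr (AC_deriveB dp1 dp2))) (AC_derive_cst (D * M)).
have dG := AC_deriveD (AC_deriveZ C (@AC_derive_id R)) dQ.
have := gronwall dF dG (lexx 0) b0.
rewrite phi10 phi20 p10 p20 !subrr expr0n/= !add0r Q0 mulr0 addr0 subr0 => H.
apply: (@le_trans _ _ (D * M * expR (C * b + Q b))); last first.
  rewrite -!mulrA !ler_wpM2l// ler_expR lerD//.
  by rewrite ler_wpM2l//; rewrite /C; lra.
apply: (@le_trans _ _ ((phi1 b - phi2 b) ^+ 2 + (p1 b - p2 b) ^+ 2 + D * M)).
  by rewrite -addrA lerDl addr_ge0 ?sqr_ge0// mulr_ge0.
apply: H => x x0 xb.
set u := phi1 x - phi2 x; set w := p1 x - p2 x.
have -> : 2 * (u * w) + 2 * (w * ((x - lam1 + q x) * phi1 x -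
    (x - lam2 + q x) * phi2 x)) + 0 =
    (1 + x - lam1 + q x) * (2 * (u * w)) + (lam2 - lam1) * (2 * (w * phi2 x)).
  by rewrite /u /w; ring.
have uw0 : 0 <= u ^+ 2 + w ^+ 2 by rewrite addr_ge0 ?sqr_ge0.
apply: (@le_trans _ _ ((1 + A + L + `|q x|) * (u ^+ 2 + w ^+ 2) +
    (u ^+ 2 + w ^+ 2 + D * M))).
  rewrite lerD//.
    rewrite (le_trans (ler_norm _))// normrM ler_pM//; last exact: norm_mul2_le_sqrD.
    rewrite (le_trans (ler_normD _ _))// lerD2r (le_trans (ler_normB _ _))//.
    by rewrite ger0_norm; lra.
  rewrite (le_trans (ler_norm _))// normrM -/D.
  apply: (@le_trans _ _ (D * (w ^+ 2 + M))).
    rewrite ler_wpM2l// (le_trans (norm_mul2_le_sqrD _ _))// lerD2l phi2M//; lra.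
  rewrite mulrDr lerD2r; have : 0 <= (1 - D) * w ^+ 2.
    by rewrite mulr_ge0 ?sqr_ge0//; lra.
  have := sqr_ge0 u; lra.
have -> : (C * 1 + `|q x|) * (u ^+ 2 + w ^+ 2 + D * M) =
  (1 + A + L + `|q x|) * (u ^+ 2 + w ^+ 2) + (u ^+ 2 + w ^+ 2 + D * M) +
  (1 + A + L + `|q x|) * (D * M) by rewrite /C; ring.
by rewrite lerDl mulr_ge0 ?mulr_ge0// ?addr_ge0//; lra.
Qed.

(* If lam1, lam2 <= L were too close, the normalised eigenfunctions would be
   close on [0, A] and have small tails, against their orthogonality, which is
   expressed here through the Wronskian V. *)
Lemma eigenvalue_gap q Q I L a : bounded_primitive (fun x => `|q x|) Q I ->
  0 <= a -> L + 1 <= a -> (forall x, a <= x -> I - 2^-1 <= Q x) ->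
  exists2 d, 0 < d & forall lam1 phi1 p1 N1 J1 lam2 phi2 p2 N2 J2,
    `|lam1| <= L -> `|lam2| <= L -> lam1 != lam2 ->
    is_solution q lam1 phi1 p1 -> p1 0 = 1 ->
    bounded_primitive (fun x => phi1 x ^+ 2) N1 J1 ->
    is_solution q lam2 phi2 p2 -> p2 0 = 1 ->
    bounded_primitive (fun x => phi2 x ^+ 2) N2 J2 ->
    d <= `|lam2 - lam1|.
Proof.
move=> HQ a0 La Qa.
have [k [c [k0 c0] Hk]] := mass_lower_bound L HQ.
pose F := expR ((1 + a + L) * a + I); have F0 : 0 < F by exact: expR_gt0.
(* Beyond [A] each solution has mass at most [k / 8], and [A >= c] keeps mass at least [k] before
   it. *)
pose A := a + c + 16 * F / k.
have Fk0 : 0 < 16 * F / k by rewrite divr_gt0// mulr_gt0.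
have A0 : 0 < A by rewrite /A; lra.
pose K := expR ((1 + A + L) * A + I) * expR ((2 + A + L) * A + I).
have K0 : 0 < K by rewrite mulr_gt0 ?expR_gt0.
exists (Num.min 1 (k / (K * A) / 2)).
  by rewrite lt_min ltr01 !divr_gt0// mulr_gt0.
move=> lam1 phi1 p1 N1 J1 lam2 phi2 p2 N2 J2 l1 l2 l12 Hs1 p10 HN1 Hs2 p20 HN2.
rewrite leNgt; apply/negP; rewrite lt_min => /andP[D1 DK].
have [dphi1 dp1 phi10] := Hs1; have [dphi2 dp2 phi20] := Hs2.
have [dN1 N10 _] := HN1; have [dN2 N20 _] := HN2.
pose l := lam1 - lam2; have l0 : l != 0 by rewrite subr_eq0.
have nl0 : 0 < `|l| by rewrite normr_gt0.
pose V x := phi1 x * p2 x - p1 x * phi2 x.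
have dV : AC_derive V (fun x => l * (phi1 x * phi2 x)).
  by apply: (eq_AC_derive (AC_deriveB (AC_deriveM dphi1 dp2)
    (AC_deriveM dp1 dphi2))) => // x _; rewrite /l; ring.
(* Primitive of [(phi1 - phi2) ^+ 2], as [V / l] is the primitive of [phi1 * phi2]. *)
pose T x := N1 x + N2 x - 2 / l * V x.
have dT : AC_derive T (fun x => (phi1 x - phi2 x) ^+ 2).
  apply: (eq_AC_derive (AC_deriveB (AC_deriveD dN1 dN2) (AC_deriveZ (2 / l) dV))) => //.
  by move=> x _; field.
have T0 : T 0 = 0 by rewrite /T /V N10 N20 phi10 phi20; ring.
have TA : T A < k.
  have : T A - T 0 <= `|lam2 - lam1| * K * A - `|lam2 - lam1| * K * 0.
    apply: (AC_derive_le dT (AC_deriveZ _ (@AC_derive_id R))) => //; first exact: ltW.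
    move=> x x0 xA; rewrite mulr1.
    exact: (solution_close HQ l1 l2 (ltW D1) Hs1 p10 Hs2 p20 (ltW x0) (ltW xA)).
  rewrite T0 mulr0 !subr0 => /le_lt_trans; apply.
  have KA : 0 < K * A by exact: mulr_gt0.
  have KA0 : 0 < k / (K * A) by exact: divr_gt0.
  rewrite -mulrA -ltr_pdivlMr//.
  by move: (k / _) KA0 DK => z; lra.
have Ht (lam : R) : `|lam| <= L -> tail_start q Q I lam a.
  by move=> lL; split => //; have := ler_norm lam; lra.
have aA : a <= A by rewrite /A; lra.
have tail (lam : R) phi p N J b : `|lam| <= L -> is_solution q lam phi p -> p 0 = 1 ->
    bounded_primitive (fun x => phi x ^+ 2) N J -> A <= b -> N b - N A <= k / 8.
  move=> lL Hs p0 HN Ab; have := tail_mass (Ht _ lL) Hs HN aA Ab.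
  have La' : 1 + a + `|lam| <= 1 + a + L by lra.
  have := energy_bound HQ Hs p0 a0 La'; rewrite -/F => H1 H2.
  have NbA : 0 <= N b - N A.
    rewrite subr_ge0; have [dN _ _] := HN; apply: (AC_derive_ge0 dN) => //.
      exact: ltW.
    by move=> x *; exact: sqr_ge0.
  have lamA : 16 * F / k <= A - lam by have := ler_norm lam; rewrite /A; lra.
  have : 16 * F / k * (N b - N A) <= 2 * F.
    by apply: le_trans (ler_wpM2r NbA lamA) _; lra.
  have -> : 16 * F / k * (N b - N A) = 2 * F * (8 / k * (N b - N A)).
    by field; rewrite gt_eqF.
  rewrite -[leRHS]mulr1 ler_pM2l ?mulr_gt0// -ler_pdivlMl ?divr_gt0// mulr1.
  by rewrite invf_div.
have mass (lam : R) phi p N J b : `|lam| <= L -> is_solution q lam phi p -> p 0 = 1 ->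
    bounded_primitive (fun x => phi x ^+ 2) N J -> A <= b -> k <= N b.
  move=> lL Hs p0 HN Ab; apply: le_trans (Hk _ _ _ _ _ lL Hs p0 HN) _.
  have [dN _ _] := HN; apply: (AC_derive_ge0 dN) => //; first by rewrite /A in Ab; lra.
  by move=> x *; exact: sqr_ge0.
have e0 : 0 < `|l| * (k / 2) by rewrite mulr_gt0// divr_gt0.
have [b [ab Ab] Wb] := small_weights (Ht _ l1) Hs1 HN1 (Ht _ l2) Hs2 HN2 A e0.
have t1 := tail _ _ _ _ _ _ l1 Hs1 p10 HN1 Ab.
have t2 := tail _ _ _ _ _ _ l2 Hs2 p20 HN2 Ab.
have m1 := mass _ _ _ _ _ _ l1 Hs1 p10 HN1 Ab.
have m2 := mass _ _ _ _ _ _ l2 Hs2 p20 HN2 Ab.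
have TbA : T b - T A <= k / 2.
  have : T b - T A <= 2 * (N1 b + N2 b) - 2 * (N1 A + N2 A).
    apply: (AC_derive_le dT (AC_deriveZ 2 (AC_deriveD dN1 dN2))) => //; first exact: ltW.
    by move=> x _ _; have := sqr_ge0 (phi1 x + phi2 x); rewrite sqrrB sqrrD; lra.
  lra.
(* Approximate orthogonality: the boundary value of the Wronskian is small against [l]. *)
have Vb : `|2 * V b| < `|l| * (k / 2).
  apply: le_lt_trans Wb.
  have -> : 2 * V b = 2 * (phi1 b * p2 b) - 2 * (p1 b * phi2 b) by rewrite /V; ring.
  rewrite (le_trans (ler_normB _ _))//.
  have := norm_mul2_le_sqrD (phi1 b) (p2 b); have := norm_mul2_le_sqrD (p1 b) (phi2 b).
  have H (lam phi : R) : `|lam| <= L -> phi ^+ 2 <= (b - lam) * phi ^+ 2.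
    move=> lL; have : 0 <= (b - lam - 1) * phi ^+ 2.
      by rewrite mulr_ge0 ?sqr_ge0//; have := ler_norm lam; lra.
    lra.
  have := H _ (phi1 b) l1; have := H _ (phi2 b) l2; lra.
have : `|2 / l * V b| <= k / 2.
  by rewrite mulrAC normrM normfV ler_pdivrMr// (mulrC (k / 2)) ltW.
rewrite ler_norml => /andP[_ V2].
(* Two masses of at least [k] minus the mixed term leave [T b >= 3 * k / 2], whereas [T A < k] and
   the tail [k / 2] give the opposite strict inequality. *)
have : 2 * k - k / 2 <= T b by rewrite /T; move: (2 / l * V b) V2 => t; lra.
move: (T b) (T A) TbA TA => Tb TA'; lra.
Qed.

End Discreteness.

(** * Normalisation of eigenfunctions and unboundedness of the eigenvalues *)

Section Eigenfunctions.
Context {R : realType}.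
Local Notation mu := (@lebesgue_measure R).
Implicit Types (q Q phi p N : R -> R) (lam I L x : R).

Lemma eigenfunction_solution q lam phi p :
  dirichlet_eigenfunction q lam phi p -> is_solution q lam phi p.
Proof.
move=> [_ [_ [acphi [acp [dphi [dp phi0]]]]]]; split=> //.
  split=> //; apply: ae_imply dphi => x H x0; have [d1 d2] := H x0.
  by split => //; rewrite -derive1E.
split=> //; apply: ae_imply dp => x H x0; have [d1 d2] := H x0.
split => //; rewrite -derive1E.
have -> : derive1 p x = (x + q x) * phi x - (- derive1 p x + (x + q x) * phi x).
  by ring.
by rewrite d2; ring.
Qed.

Lemma L2_pos_integrable f : L2_pos f ->
  mu.-integrable (`[0, +oo[ : set R) (EFin \o (fun x => f x ^+ 2)).
Proof.
move=> [mf foo]; apply/integrableP; split.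
  by apply/measurable_EFinP; exact: measurable_funX.
apply: le_lt_trans foo; rewrite le_eqVlt; apply/orP; left; apply/eqP.
by apply: eq_integral => x _ /=; rewrite ger0_norm ?sqr_ge0.
Qed.

(** Division by [p 0], nonzero by uniqueness, turns the reciprocal norming constant into the squared
    norm of a solution with unit slope. *)
Lemma eigenfunction_normalised q Q I lam phi p :
  bounded_primitive (fun x => `|q x|) Q I ->
  dirichlet_eigenfunction q lam phi p ->
  exists psi r N, [/\ is_solution q lam psi r, r 0 = 1,
    bounded_primitive (fun x => psi x ^+ 2) N (normsq phi / p 0 ^+ 2) &
    forall d, 0 < d -> exists2 b, 0 <= b &
      forall x, b <= x -> normsq phi / p 0 ^+ 2 - d <= N x].
Proof.
move=> HQ He; have Hs := eigenfunction_solution He.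
have [L2phi [phin0 _]] := He.
have p0 : p 0 != 0.
  apply/eqP => p0; apply: phin0; apply: aeW => x x0.
  exact: solution_eq0 HQ Hs p0 x x0.
have [N [dN N0 NJ Ntail]] :=
  primitive_AC_derive (fun x _ => sqr_ge0 (phi x)) (L2_pos_integrable L2phi).
rewrite -/(normsq phi) in NJ Ntail.
pose c := (p 0)^-1; have c20 : 0 < c ^+ 2 by rewrite exprn_even_gt0// invr_neq0.
have -> : normsq phi / p 0 ^+ 2 = c ^+ 2 * normsq phi by rewrite mulrC exprVn.
exists (fun x => c * phi x), (fun x => c * p x), (fun x => c ^+ 2 * N x); split.
- exact: solutionZ.
- by rewrite mulVf.
- split; last by move=> x; rewrite ler_pM2l.
    by apply: (eq_AC_derive (AC_deriveZ (c ^+ 2) dN)) => // x _; rewrite exprMn.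
  by rewrite N0 mulr0.
- move=> d d0; have dc0 : 0 < d / c ^+ 2 by rewrite divr_gt0.
  have [b b0 Hb] := Ntail _ dc0; exists b => // x bx.
  have := Hb x bx; rewrite -(ler_pM2l c20) mulrBr mulrCA divff ?mulr1//.
  by rewrite gt_eqF.
Qed.

(** Otherwise all [lam k] lie in a bounded set, where consecutive ones are at least a fixed [d]
    apart. *)
Lemma eigenvalues_unbounded q Q I (lam : nat -> R) (phi p : nat -> R -> R) L :
  bounded_primitive (fun x => `|q x|) Q I ->
  (forall e, 0 < e -> exists2 a, 0 <= a & forall x, a <= x -> I - e <= Q x) ->
  (forall k, lam k < lam k.+1) ->
  (forall k, dirichlet_eigenfunction q (lam k) (phi k) (p k)) ->
  exists k, L < lam k.
Proof.
move=> HQ Qtail lam_incr Heig; apply: contrapT => nex.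
have lamL k : lam k <= L by rewrite leNgt; apply/negP => H; apply: nex; exists k.
have lam_mono : {homo lam : m n / (m <= n)%N >-> m <= n}.
  by apply: homo_leq => // [x y z|k]; [exact: le_trans|exact: ltW].
pose L' := Num.max L (- lam 0%N).
have LL' : L <= L' by rewrite le_max lexx.
have lam0L' : - lam 0%N <= L' by rewrite le_max lexx orbT.
have lamL' k : `|lam k| <= L'.
  by rewrite ler_norml; have := lamL k; have := lam_mono 0%N k (leq0n k); lra.
have half0 : 0 < 2^-1 :> R by rewrite invr_gt0.
have [a0 a00 Ha0] := Qtail _ half0.
pose a := Num.max a0 (L' + 1).
have [||| d d0 gap] := @eigenvalue_gap R q Q I L' a HQ.
- by rewrite le_max a00.
- by rewrite le_max lexx orbT.
- by move=> x; rewrite ge_max => /andP[/Ha0].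
have step k : d <= lam k.+1 - lam k.
  have [psi1 [r1 [N1 [Hs1 r10 HN1 _]]]] := eigenfunction_normalised HQ (Heig k).
  have [psi2 [r2 [N2 [Hs2 r20 HN2 _]]]] := eigenfunction_normalised HQ (Heig k.+1).
  rewrite -(@gtr0_norm _ (_ - _)) ?subr_gt0//.
  by apply: (gap _ _ _ _ _ _ _ _ _ _ (lamL' k) (lamL' k.+1) _ Hs1 r10 HN1 Hs2 r20 HN2);
    rewrite lt_eqF.
have grow k : lam 0%N + k%:R * d <= lam k.
  elim: k => [|k IH]; first by rewrite mul0r addr0.
  by rewrite -natr1 mulrDl mul1r; have := step k; lra.
have L0 : 0 <= L - lam 0%N by rewrite subr_ge0.
have := archi_boundP (divr_ge0 L0 (ltW d0)); rewrite ltr_pdivrMr//.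
have := grow (Num.bound ((L - lam 0%N) / d)).
by have := lamL (Num.bound ((L - lam 0%N) / d)); lra.
Qed.

End Eigenfunctions.

(** * Passage to the limit, with constants chosen for a given accuracy *)

Unset Implicit Arguments.

Theorem theorem3p6 (R : realType) (q : R -> R) (hq : L1_pos q)
    (lam : nat -> R) (lam_incr : forall k, lam k < lam k.+1)
    (lam_enum : forall mu, dirichlet_eigenvalue q mu <-> exists k, lam k = mu)
    (phi dphi : nat -> R -> R)
    (hphi : forall k, dirichlet_eigenfunction q (lam k) (phi k) (dphi k)) :
  (fun k => normsq (phi k) / (dphi k 0) ^+ 2) @ \oo --> (1 : R).
Proof.
have [Q [dQ Q0 QI Qtail]] := primitive_AC_derive
  (fun x _ => normr_ge0 (q x)) (integrable_abse hq).
move: QI Qtail; set I := fine _ => QI Qtail.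
have HQ : bounded_primitive (fun x => `|q x|) Q I by [].
have I0 : 0 <= I by rewrite -Q0 QI.
have lam_mono : {homo lam : m n / (m <= n)%N >-> m <= n}.
  by apply: homo_leq => // [x y z|k]; [exact: le_trans|exact: ltW].
apply/cvgrPdist_lt => e e0.
set B := 6 * expR (4 + 2 * I); have B0 : 0 < B by rewrite mulr_gt0// expR_gt0.
(* Keeps the second error term of [norming_estimate] below [e / 4]; the cap 1/2 is the one required
   there. *)
pose e1 := Num.min 2^-1 (e / 4 / B).
have e40 : 0 < e / 4 by rewrite divr_gt0.
have e10 : 0 < e1 by rewrite lt_min invr_gt0 ltr0n /= divr_gt0.
have e1B : B * e1 <= e / 4.
  by rewrite mulrC -ler_pdivlMr// ge_min lexx orbT.
have e12 : e1 <= 2^-1 by rewrite ge_min lexx.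
have [M M0 HM] := Qtail _ e10.
(* Keeps the first error term below [e / 4]. *)
pose s := 1 + expR I * I / (e / 4).
have E0 : 0 <= expR I * I by rewrite mulr_ge0 ?expR_ge0.
have s1 : 1 <= s by rewrite lerDl divr_ge0// ltW.
have sE : expR I * I / s <= e / 4.
  rewrite ler_pdivrMr; last lra.
  rewrite /s mulrDr mulr1 mulrCA divff ?mulr1 ?gt_eqF//; lra.
have [k0 Hk0] := eigenvalues_unbounded (M + s ^+ 2) HQ Qtail lam_incr hphi.
exists k0 => // k /= k0k.
have [psi [r [N [Hs r0 HN Ntail]]]] := eigenfunction_normalised HQ (hphi k).
have lamk : M + s ^+ 2 <= lam k by have := lam_mono _ _ k0k; lra.
rewrite distrC.
by have := norming_estimate HQ Hs HN Ntail r0 s1 M0 lamk e12 HM; rewrite -/B; lra.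
Qed.
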